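(* If $\eta=\mu$ and $\gamma>\bar\gamma_1$, then with $$b_2=b_2^\gamma:=\inf\{x>0:v'(x)<1\}=\hat x+g_4^{-1}\Big(\frac{1}{\lambda_\gamma\delta}\Big[\delta+\frac{\lambda_\gamma\mu\gamma}{\delta+\gamma}\Big]\Big),\qquad b_1=\hat x,$$ the function $v:[0,\infty)\to\mathbb{R}$, $v(0)=0$, given (and extended by continuity at $\hat x$ and $b_2$) by $$v(x)=\begin{cases}c_{4,1}(b_2)x^{\delta\bar\eta/[1+\delta\bar\eta]}&x\in(0,\hat x),\\ c_{4,1}(b_2)h_3(x-\hat x)&x\in(\hat x,b_2),\\ c_{4,2}(b_2)e^{\lambda_\gamma[x-b_2]}+\frac{\gamma}{\gamma+\delta}\big[x-b_2+v(b_2)+\frac{\mu}{\delta+\gamma}\big]&x\in(b_2,\infty),\end{cases}$$ is a $C^2$, increasing and concave function on $(0,\infty)$ satisfying $$-\frac{\mu^2[v'(x)]^2}{2\sigma^2v''(x)}-\delta v(x)+\gamma\{x-b_2+v(b_2)-v(x)\}\mathbf 1_{\{x>b_2\}}=0,\quad x\in(0,b_1),$$ $$\tfrac12\sigma^2v''(x)+\mu v'(x)-\delta v(x)+\gamma\{x-b_2+v(b_2)-v(x)\}\mathbf 1_{\{x>b_2\}}=0,\quad x\in(b_1,\infty),$$ and $v(0)=0$. Furthermore, $v'/v''$ is decreasing on $(0,\infty)$ and satisfies $\lim_{x\downarrow0}\frac{\mu}{\sigma^2}\frac{v'(x)}{v''(x)}>-1$, and $b_1^\gamma:=\inf\{x>0:-\frac{\mu}{\sigma^2}\frac{v'(x)}{v''(x)}\ge1\}=\hat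 x$.
   Context: Constants: $\mu=\eta>0$, $\sigma>0$, $\delta>0$, $\gamma>0$. $\lambda_\gamma$ is the negative root of $\frac{\sigma^2}{2}r^2+\mu r-(\delta+\gamma)=0$; $\theta_+>0>\theta_-$ are the roots of $\frac{\sigma^2}{2}r^2+\mu r-\delta=0$. $\bar\eta=\frac{2\sigma^2}{\mu^2}$, $\hat x=\frac{\sigma^2}{\mu[1+\delta\bar\eta]}$. $h_3(x)=\frac{1}{\theta_+-\theta_-}[\bar a_1e^{\theta_+x}-\bar a_2e^{\theta_-x}]$ with $\bar a_1=\frac{\delta\bar\eta}{1+\delta\bar\eta}\hat x^{-1/[1+\delta\bar\eta]}-\theta_-\hat x^{\delta\bar\eta/[1+\delta\bar\eta]}$ and $\bar a_2=\frac{\delta\bar\eta}{1+\delta\bar\eta}\hat x^{-1/[1+\delta\bar\eta]}-\theta_+\hat x^{\delta\bar\eta/[1+\delta\bar\eta]}$. $g_4(b)=h_3(b)/h_3'(b)$ for $b>0$; $g_4$ is increasing from $g_4(0+)=\frac{\mu}{2\delta}$ to $g_4(\infty)=1/\theta_+$, with inverse $g_4^{-1}$. $f_1(\gamma)=\frac{1}{\lambda_\gamma\delta}\big[\delta+\frac{\lambda_\gamma\mu\gamma}{\delta+\gamma}\big]$ for $\gamma>0$; it is strictly increasing from $1/\theta_-$ to $\mu/\delta<1/\theta_+$; $\bar\gamma_1=f_1^{-1}\big(\frac{\mu}{2\delta}\big)$. $$c_{4,1}(b_2)=\frac{\frac{\gamma}{\gamma+\delta}-\frac{\mu\gamma\lambda_\gamma}{(\delta+\gamma)^2}}{h_3'(b_2-\hat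 x)-\frac{\lambda_\gamma\delta}{\gamma+\delta}h_3(b_2-\hat x)},\qquad c_{4,2}(b_2)=\frac{\delta}{\delta+\gamma}c_{4,1}(b_2)h_3(b_2-\hat x)-\frac{\mu\gamma}{(\delta+\gamma)^2}.$$ *)

(* Defs.v *)
From Stdlib Require Import Reals Lra.
From Coquelicot Require Import Coquelicot.
Open Scope R_scope.

(* The case eta = mu is expressed by writing mu for both constants.
   [iota P] is Coquelicot's definite description: the unique real satisfying P. *)

Definition quad (mu sigma q r : R) : R := sigma ^ 2 / 2 * r ^ 2 + mu * r - q.

Definition lambda (mu sigma delta gamma : R) : R :=
  iota (fun r : R => r < 0 /\ quad mu sigma (delta + gamma) r = 0).

Definition theta_plus (mu sigma delta : R) : R :=
  iota (fun r : R => 0 < r /\ quad mu sigma delta r = 0).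

Definition theta_minus (mu sigma delta : R) : R :=
  iota (fun r : R => r < 0 /\ quad mu sigma delta r = 0).

Definition eta_bar (mu sigma : R) : R := 2 * sigma ^ 2 / mu ^ 2.

Definition xhat (mu sigma delta : R) : R :=
  sigma ^ 2 / (mu * (1 + delta * eta_bar mu sigma)).

Definition expo (mu sigma delta : R) : R :=
  delta * eta_bar mu sigma / (1 + delta * eta_bar mu sigma).

(* The coefficients a_1 and a_2 of h_3 are [a_bar] at theta_- and theta_+. *)
Definition a_bar (mu sigma delta theta : R) : R :=
  expo mu sigma delta
    * Rpower (xhat mu sigma delta) (- 1 / (1 + delta * eta_bar mu sigma))
  - theta * Rpower (xhat mu sigma delta) (expo mu sigma delta).

Definition a1_bar (mu sigma delta : R) : R :=
  a_bar mu sigma delta (theta_minus mu sigma delta).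

Definition a2_bar (mu sigma delta : R) : R :=
  a_bar mu sigma delta (theta_plus mu sigma delta).

Definition h3 (mu sigma delta x : R) : R :=
  1 / (theta_plus mu sigma delta - theta_minus mu sigma delta)
  * (a1_bar mu sigma delta * exp (theta_plus mu sigma delta * x)
     - a2_bar mu sigma delta * exp (theta_minus mu sigma delta * x)).

Definition g4 (mu sigma delta b : R) : R :=
  h3 mu sigma delta b / Derive (h3 mu sigma delta) b.

Definition g4_inv (mu sigma delta y : R) : R :=
  iota (fun b : R => 0 < b /\ g4 mu sigma delta b = y).

Definition f1 (mu sigma delta gamma : R) : R :=
  1 / (lambda mu sigma delta gamma * delta)
  * (delta + lambda mu sigma delta gamma * mu * gamma / (delta + gamma)).

Definition gamma1_bar (mu sigma delta : R) : R :=
  iota (fun g : R => 0 < g /\ f1 mu sigma delta g = mu / (2 * delta)).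

Definition c41 (mu sigma delta gamma b2 : R) : R :=
  (gamma / (gamma + delta)
   - mu * gamma * lambda mu sigma delta gamma / (delta + gamma) ^ 2)
  / (Derive (h3 mu sigma delta) (b2 - xhat mu sigma delta)
     - lambda mu sigma delta gamma * delta / (gamma + delta)
       * h3 mu sigma delta (b2 - xhat mu sigma delta)).

Definition c42 (mu sigma delta gamma b2 : R) : R :=
  delta / (delta + gamma) * c41 mu sigma delta gamma b2
    * h3 mu sigma delta (b2 - xhat mu sigma delta)
  - mu * gamma / (delta + gamma) ^ 2.

(* The middle branch includes both end points xhat and b2, so that the values
   there are its one-sided limits; v(b2) on the last branch is therefore
   c41 * h3 (b2 - xhat), see [vfun_above].  Only the values on [0, oo) matter;
   0 needs its own branch since [Rpower 0 p] is 1. *)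
Definition vfun (mu sigma delta gamma b2 x : R) : R :=
  if Rle_dec x 0 then 0
  else if Rlt_dec x (xhat mu sigma delta) then
    c41 mu sigma delta gamma b2 * Rpower x (expo mu sigma delta)
  else if Rle_dec x b2 then
    c41 mu sigma delta gamma b2 * h3 mu sigma delta (x - xhat mu sigma delta)
  else
    c42 mu sigma delta gamma b2 * exp (lambda mu sigma delta gamma * (x - b2))
    + gamma / (gamma + delta)
      * (x - b2
         + c41 mu sigma delta gamma b2
           * h3 mu sigma delta (b2 - xhat mu sigma delta)
         + mu / (delta + gamma)).

Lemma vfun_above (mu sigma delta gamma b2 x : R) :
  0 < xhat mu sigma delta < b2 -> b2 < x ->
  vfun mu sigma delta gamma b2 x =
  c42 mu sigma delta gamma b2 * exp (lambda mu sigma delta gamma * (x - b2))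
  + gamma / (gamma + delta)
    * (x - b2 + vfun mu sigma delta gamma b2 b2 + mu / (delta + gamma)).
Proof.
intros [H1 H2] Hx; unfold vfun.
destruct (Rle_dec x 0); [lra|].
destruct (Rlt_dec x (xhat mu sigma delta)); [lra|].
destruct (Rle_dec x b2); [lra|].
destruct (Rle_dec b2 0); [lra|].
destruct (Rlt_dec b2 (xhat mu sigma delta)); [lra|].
destruct (Rle_dec b2 b2); [reflexivity|lra].
Qed.

Definition C2_on_pos (f : R -> R) : Prop :=
  forall x, 0 < x ->
    ex_derive f x /\ ex_derive (Derive f) x /\ continuous (Derive_n f 2) x.

Definition increasing_on_pos (f : R -> R) : Prop :=
  forall x y, 0 < x -> x < y -> f x < f y.

Definition decreasing_on_pos (f : R -> R) : Prop :=
  forall x y, 0 < x -> x < y -> f y < f x.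

Definition concave_on_pos (f : R -> R) : Prop :=
  forall x y t, 0 < x -> 0 < y -> 0 <= t <= 1 ->
    t * f x + (1 - t) * f y <= f (t * x + (1 - t) * y).

Definition indicator_gt (b x : R) : R := if Rlt_dec b x then 1 else 0.

(* Main.v *)
(* Every implicit quantity has a closed form.  At gamma1_bar the root lambda is
   -2 (delta/mu + mu/sigma^2), so gamma1_bar < gamma gives
   mu/(2 delta) < f1 gamma < mu/delta, and g4 b = y is an equation for
   exp((theta_+ - theta_-) b).  With g4 (b2 - xhat) = f1 gamma the coefficients
   collapse to c41 = 1/h3'(b2 - xhat) and c42 = delta/((delta + gamma) lambda);
   thus v'(b2) = 1 and v(b2) = f1 gamma, and the ODEs on both sides of each
   junction force the second derivatives to agree there.  Since v'' < 0, v' is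
   decreasing and crosses 1 at b2.  On the first piece
   -(mu/sigma^2) v'/v'' = x/xhat; on the second, monotonicity of v'/v'' is the
   sign of a 2x2 determinant of exponentials; on the third, v'/v'' is a
   constant minus a multiple of exp(-lambda x). *)

Require Import Defs.
From Stdlib Require Import Reals Lra.
From Coquelicot Require Import Coquelicot.
Open Scope R_scope.

(** * Roots of the characteristic quadratics *)

(** Completing the square turns the equation into (sigma^2 r + mu)^2 = s^2 with s^2 = mu^2 + 2
    sigma^2 q. Since s > mu, only the sign giving -mu - s leads to a negative r. *)
Lemma quad_neg_root_exists (mu sigma q : R) :
  0 < mu -> 0 < sigma -> 0 < q ->
  exists! r : R, r < 0 /\ quad mu sigma q r = 0.
Proof.
intros Hm Hs Hq.
assert (Hs2 : 0 < sigma ^ 2) by (apply pow_lt; lra).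
assert (Hd : 0 <= mu ^ 2 + 2 * sigma ^ 2 * q) by nra.
pose proof (sqrt_pos (mu ^ 2 + 2 * sigma ^ 2 * q)) as Hr.
pose proof (pow2_sqrt _ Hd) as Hr2.
set (s := sqrt (mu ^ 2 + 2 * sigma ^ 2 * q)) in *.
exists ((- mu - s) / sigma ^ 2); split.
- split.
  + apply Ropp_lt_cancel; rewrite Ropp_0.
    replace (- ((- mu - s) / sigma ^ 2)) with ((mu + s) / sigma ^ 2)
      by (field; lra).
    apply Rdiv_lt_0_compat; lra.
  + unfold quad.
    replace (sigma ^ 2 / 2 * ((- mu - s) / sigma ^ 2) ^ 2
             + mu * ((- mu - s) / sigma ^ 2) - q)
      with ((s ^ 2 - (mu ^ 2 + 2 * sigma ^ 2 * q)) / (2 * sigma ^ 2))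
      by (field; lra).
    rewrite Hr2; field; lra.
- intros r [Hr0 Hq0]; unfold quad in Hq0.
  assert (E : (sigma ^ 2 * r + mu + s) * (sigma ^ 2 * r + mu - s) = 0).
  { replace ((sigma ^ 2 * r + mu + s) * (sigma ^ 2 * r + mu - s))
      with ((sigma ^ 2 * r + mu) ^ 2 - s ^ 2) by ring.
    rewrite Hr2; nra. }
  assert (mu < s) by (apply Rsqr_incrst_0; unfold Rsqr; nra).
  destruct (Rmult_integral _ _ E); [|nra].
  apply Rmult_eq_reg_l with (sigma ^ 2); [|lra].
  replace (sigma ^ 2 * ((- mu - s) / sigma ^ 2)) with (- mu - s)
    by (field; lra).
  lra.
Qed.

(** By Vieta the two roots add up to -2 mu / sigma^2, so the positive one is obtained from the
    negative one. *)
Lemma quad_pos_root_exists (mu sigma q : R) :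
  0 < mu -> 0 < sigma -> 0 < q ->
  exists! r : R, 0 < r /\ quad mu sigma q r = 0.
Proof.
intros Hm Hs Hq.
assert (Hs2 : 0 < sigma ^ 2) by (apply pow_lt; lra).
destruct (quad_neg_root_exists mu sigma q Hm Hs Hq) as [r [[Hr0 Hr1] Hru]].
unfold quad in *.
assert (Hp : sigma ^ 2 * (- (2 * mu / sigma ^ 2) - r)
             = - 2 * mu - sigma ^ 2 * r) by (field; lra).
set (p := - (2 * mu / sigma ^ 2) - r) in *.
exists p; split.
- split.
  + apply Rmult_lt_reg_l with (sigma ^ 2); [lra|]. rewrite Hp; nra.
  + replace (sigma ^ 2 / 2 * p ^ 2 + mu * p - q)
      with (sigma ^ 2 * p * p / 2 + mu * p - q) by field.
    rewrite Hp; nra.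
- intros x [Hx0 Hx1].
  assert (E : (x - r) * (sigma ^ 2 * x - sigma ^ 2 * p) = 0)
    by (rewrite Hp; nra).
  destruct (Rmult_integral _ _ E); [lra|].
  apply Rmult_eq_reg_l with (sigma ^ 2); lra.
Qed.

Lemma lambda_spec (mu sigma delta gamma : R) :
  0 < mu -> 0 < sigma -> 0 < delta -> 0 < gamma ->
  lambda mu sigma delta gamma < 0 /\
  quad mu sigma (delta + gamma) (lambda mu sigma delta gamma) = 0.
Proof.
intros; apply (iota_correct (fun r => r < 0 /\ quad mu sigma _ r = 0)).
apply quad_neg_root_exists; lra.
Qed.

Lemma theta_minus_spec (mu sigma delta : R) :
  0 < mu -> 0 < sigma -> 0 < delta ->
  theta_minus mu sigma delta < 0 /\
  quad mu sigma delta (theta_minus mu sigma delta) = 0.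
Proof.
intros; apply (iota_correct (fun r => r < 0 /\ quad mu sigma _ r = 0)).
apply quad_neg_root_exists; lra.
Qed.

Lemma theta_plus_spec (mu sigma delta : R) :
  0 < mu -> 0 < sigma -> 0 < delta ->
  0 < theta_plus mu sigma delta /\
  quad mu sigma delta (theta_plus mu sigma delta) = 0.
Proof.
intros; apply (iota_correct (fun r => 0 < r /\ quad mu sigma _ r = 0)).
apply quad_pos_root_exists; lra.
Qed.

(** * The threshold for gamma and the range of [f1] above it *)

(** Eliminating gamma through the quadratic makes both sides rational in [lambda]. As [lambda] is
    negative, the sign of the difference is opposite to that of the last factor of the numerator. *)
Lemma f1_sub (mu sigma delta gamma : R) :
  0 < mu -> 0 < sigma -> 0 < delta -> 0 < gamma ->
  f1 mu sigma delta gamma - mu / (2 * delta) =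
  lambda mu sigma delta gamma * sigma ^ 2 * mu
  * (lambda mu sigma delta gamma + 2 * (delta / mu + mu / sigma ^ 2))
  / (4 * delta * (delta + gamma)).
Proof.
intros Hm Hs Hd Hg.
assert (Hs2 : 0 < sigma ^ 2) by (apply pow_lt; lra).
destruct (lambda_spec mu sigma delta gamma Hm Hs Hd Hg) as [L0 L1].
unfold f1; set (l := lambda mu sigma delta gamma) in *; clearbody l.
unfold quad in L1.
assert (Eg : gamma = sigma ^ 2 / 2 * l ^ 2 + mu * l - delta) by lra.
assert (0 < delta + gamma) by lra.
subst gamma; field; repeat split; try lra; nra.
Qed.

(** q2 - q1 is r2 - r1 times a secant slope, and that slope is negative: q1 > 0 and r1 < 0 force
    sigma^2 r1 / 2 + mu < 0. *)
Lemma quad_neg_root_ltE (mu sigma q1 q2 r1 r2 : R) :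
  0 < mu -> 0 < q1 -> 0 < q2 -> r1 < 0 -> r2 < 0 ->
  quad mu sigma q1 r1 = 0 -> quad mu sigma q2 r2 = 0 ->
  q1 < q2 <-> r2 < r1.
Proof.
unfold quad; intros Hm Hq1 Hq2 Hr1 Hr2 E1 E2.
assert (S1 : sigma ^ 2 / 2 * r1 + mu < 0) by nra.
assert (S2 : sigma ^ 2 / 2 * r2 < 0) by nra.
assert (E : q2 - q1 = (r2 - r1) * (sigma ^ 2 / 2 * r1 + mu + sigma ^ 2 / 2 * r2))
  by nra.
split; intro; nra.
Qed.

Lemma quad_neg_root_injective (mu sigma q1 q2 r : R) :
  quad mu sigma q1 r = 0 -> quad mu sigma q2 r = 0 -> q1 = q2.
Proof. unfold quad; lra. Qed.

(* The value of [lambda] at [gamma1_bar], where the last factor in [f1_sub] vanishes. *)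
Definition lambda1 (mu sigma delta : R) : R :=
  - (2 * (delta / mu + mu / sigma ^ 2)).

Lemma lambda1_neg (mu sigma delta : R) :
  0 < mu -> 0 < sigma -> 0 < delta -> lambda1 mu sigma delta < 0.
Proof.
intros; unfold lambda1.
assert (0 < delta / mu) by (apply Rdiv_lt_0_compat; lra).
assert (0 < mu / sigma ^ 2) by (apply Rdiv_lt_0_compat; [|apply pow_lt]; lra).
lra.
Qed.

(** Solving the quadratic for gamma at the root [lambda1] produces the closed form of
    [gamma1_bar]. *)
Lemma quad_lambda1 (mu sigma delta : R) :
  0 < mu -> 0 < sigma ->
  quad mu sigma (delta + (delta + 2 * sigma ^ 2 * delta ^ 2 / mu ^ 2))
    (lambda1 mu sigma delta) = 0.
Proof. intros; unfold quad, lambda1; field; lra. Qed.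

Lemma gamma1_pos (mu sigma delta : R) :
  0 < mu -> 0 < sigma -> 0 < delta ->
  0 < delta + 2 * sigma ^ 2 * delta ^ 2 / mu ^ 2.
Proof.
intros Hm Hs Hd.
assert (0 < sigma ^ 2 * delta ^ 2) by (apply Rmult_lt_0_compat; apply pow_lt; lra).
assert (0 < 2 * sigma ^ 2 * delta ^ 2 / mu ^ 2); [|lra].
apply Rdiv_lt_0_compat; [lra|apply pow_lt; lra].
Qed.

(** By [f1_sub], f1 g = mu / (2 delta) forces lambda = [lambda1], and a root determines the constant
    term of its quadratic. *)
Lemma gamma1_bar_eq (mu sigma delta : R) :
  0 < mu -> 0 < sigma -> 0 < delta ->
  gamma1_bar mu sigma delta = delta + 2 * sigma ^ 2 * delta ^ 2 / mu ^ 2.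
Proof.
intros Hm Hs Hd.
assert (Hs2 : 0 < sigma ^ 2) by (apply pow_lt; lra).
assert (Hg1 : 0 < delta + 2 * sigma ^ 2 * delta ^ 2 / mu ^ 2)
  by (apply gamma1_pos; assumption).
pose proof (quad_lambda1 mu sigma delta Hm Hs) as Q1.
pose proof (lambda1_neg mu sigma delta Hm Hs Hd) as N1.
set (g1 := delta + 2 * sigma ^ 2 * delta ^ 2 / mu ^ 2) in *.
apply (iota_unique (fun g : R => 0 < g /\ f1 mu sigma delta g = mu / (2 * delta))).
- intros g [Hg Eg].
  destruct (lambda_spec mu sigma delta g Hm Hs Hd Hg) as [L0 L1].
  pose proof (f1_sub mu sigma delta g Hm Hs Hd Hg) as F.
  rewrite Eg in F.
  assert (Elam : lambda mu sigma delta g = lambda1 mu sigma delta).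
  { unfold lambda1.
    apply Rmult_eq_reg_l
      with (lambda mu sigma delta g * sigma ^ 2 * mu / (4 * delta * (delta + g))).
    - apply Rminus_diag_uniq.
      transitivity (mu / (2 * delta) - mu / (2 * delta)); [rewrite F|]; field; lra.
    - apply Rmult_integral_contrapositive_currified.
      + apply Rlt_not_eq; assert (0 < sigma ^ 2 * mu) by nra; nra.
      + apply Rinv_neq_0_compat; nra. }
  rewrite Elam in L1.
  pose proof (quad_neg_root_injective _ _ _ _ _ L1 Q1); lra.
- split; [exact Hg1|].
  destruct (lambda_spec mu sigma delta g1 Hm Hs Hd Hg1) as [L0 L1].
  pose proof (f1_sub mu sigma delta g1 Hm Hs Hd Hg1) as F.
  assert (Elam : lambda mu sigma delta g1 = lambda1 mu sigma delta).
  (* Two negative roots of the same quadratic coincide: a strict order between them would give delta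
     + g1 < delta + g1. *)
  { pose proof (quad_neg_root_ltE mu sigma (delta + g1) (delta + g1) _ _ Hm
      ltac:(lra) ltac:(lra) L0 N1 L1 Q1).
    pose proof (quad_neg_root_ltE mu sigma (delta + g1) (delta + g1) _ _ Hm
      ltac:(lra) ltac:(lra) N1 L0 Q1 L1).
    destruct (Rtotal_order (lambda mu sigma delta g1) (lambda1 mu sigma delta))
      as [|[|]]; lra. }
  rewrite Elam in F.
  replace (lambda1 mu sigma delta + 2 * (delta / mu + mu / sigma ^ 2)) with 0 in F
    by (unfold lambda1; ring).
  apply Rminus_diag_uniq; rewrite F; unfold Rdiv; ring.
Qed.

(** Below: gamma above the threshold puts [lambda] below [lambda1], which fixes the sign in
    [f1_sub]. Above: f1 - mu/delta = 1/lambda - mu/(delta + gamma), a sum of two negative terms. *)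
Lemma f1_bounds (mu sigma delta gamma : R) :
  0 < mu -> 0 < sigma -> 0 < delta -> 0 < gamma ->
  gamma1_bar mu sigma delta < gamma ->
  mu / (2 * delta) < f1 mu sigma delta gamma < mu / delta.
Proof.
intros Hm Hs Hd Hg Hgg.
destruct (lambda_spec mu sigma delta gamma Hm Hs Hd Hg) as [L0 L1].
split.
- pose proof (f1_sub mu sigma delta gamma Hm Hs Hd Hg) as F.
  pose proof (quad_lambda1 mu sigma delta Hm Hs) as Q1.
  pose proof (lambda1_neg mu sigma delta Hm Hs Hd) as N1.
  rewrite <- gamma1_bar_eq in Q1 by assumption.
  assert (Hg1 : 0 < gamma1_bar mu sigma delta).
  { rewrite gamma1_bar_eq by assumption; apply gamma1_pos; assumption. }
  pose proof (proj1 (quad_neg_root_ltE mu sigma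
    (delta + gamma1_bar mu sigma delta) (delta + gamma) _ _ Hm
    ltac:(lra) ltac:(lra) N1 L0 Q1 L1) ltac:(lra)) as Hl.
  unfold lambda1 in Hl.
  apply Rlt_0_minus; rewrite F; apply Rdiv_lt_0_compat; [|nra].
  assert (0 < sigma ^ 2 * mu) by (apply Rmult_lt_0_compat; [apply pow_lt|]; lra).
  replace (lambda mu sigma delta gamma * sigma ^ 2 * mu)
    with (- (sigma ^ 2 * mu * - lambda mu sigma delta gamma)) by ring.
  assert (0 < sigma ^ 2 * mu * - lambda mu sigma delta gamma)
    by (apply Rmult_lt_0_compat; lra).
  nra.
- unfold f1.
  replace (1 / (lambda mu sigma delta gamma * delta)
           * (delta + lambda mu sigma delta gamma * mu * gamma / (delta + gamma)))
    with (mu / delta - (mu / (delta + gamma) - / lambda mu sigma delta gamma))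
    by (field; lra).
  pose proof (Rinv_lt_0_compat _ L0).
  assert (0 < mu / (delta + gamma)) by (apply Rdiv_lt_0_compat; lra).
  lra.
Qed.

(** * Constants and power function of the first piece *)

Lemma eta_bar_pos (mu sigma : R) : 0 < mu -> 0 < sigma -> 0 < eta_bar mu sigma.
Proof.
intros; apply Rdiv_lt_0_compat; [apply Rmult_lt_0_compat; [lra|]|]; apply pow_lt; lra.
Qed.

Lemma xhat_pos (mu sigma delta : R) :
  0 < mu -> 0 < sigma -> 0 < delta -> 0 < xhat mu sigma delta.
Proof.
intros Hm Hs Hd; pose proof (eta_bar_pos mu sigma Hm Hs).
assert (0 < delta * eta_bar mu sigma) by (apply Rmult_lt_0_compat; lra).
apply Rdiv_lt_0_compat; [apply pow_lt; lra|nra].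
Qed.

Lemma expo_bounds (mu sigma delta : R) :
  0 < mu -> 0 < sigma -> 0 < delta -> 0 < expo mu sigma delta < 1.
Proof.
intros Hm Hs Hd; pose proof (eta_bar_pos mu sigma Hm Hs); unfold expo.
assert (0 < delta * eta_bar mu sigma) by (apply Rmult_lt_0_compat; lra).
split; [apply Rdiv_lt_0_compat; lra|].
apply Rmult_lt_reg_r with (1 + delta * eta_bar mu sigma); [lra|].
field_simplify; lra.
Qed.

(** For u = x^expo one has -u'/u'' = x / (1 - expo); the identity says that [xhat] is where
    (mu/sigma^2) times this reaches 1. *)
Lemma xhat_mul (mu sigma delta : R) :
  0 < mu -> 0 < sigma -> 0 < delta ->
  xhat mu sigma delta * mu = sigma ^ 2 * (1 - expo mu sigma delta).
Proof.
intros Hm Hs Hd; pose proof (eta_bar_pos mu sigma Hm Hs).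
unfold xhat, expo; field; split; nra.
Qed.

(** expo/xhat is the logarithmic derivative of x^expo at [xhat]; its value 2 delta / mu is the
    constant K used for h3 below. *)
Lemma expo_div_xhat (mu sigma delta : R) :
  0 < mu -> 0 < sigma -> 0 < delta ->
  expo mu sigma delta = 2 * delta / mu * xhat mu sigma delta.
Proof.
intros Hm Hs Hd; pose proof (eta_bar_pos mu sigma Hm Hs).
pose proof (pow_lt sigma 2 Hs) as Hs2; pose proof (pow_lt mu 2 Hm) as Hm2.
unfold xhat, expo.
replace (2 * delta / mu * (sigma ^ 2 / (mu * (1 + delta * eta_bar mu sigma))))
  with (delta * (2 * sigma ^ 2 / mu ^ 2) / (1 + delta * eta_bar mu sigma)).
- reflexivity.
- field; split; nra.
Qed.

Lemma Rpower_minus_1 (x p : R) : 0 < x -> Rpower x (p - 1) = Rpower x p / x.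
Proof.
intro; unfold Rminus; rewrite Rpower_plus, Rpower_Ropp, Rpower_1 by assumption.
reflexivity.
Qed.

Lemma is_derive_Rpower_l (x p : R) :
  0 < x -> is_derive (fun y => Rpower y p) x (p * Rpower x (p - 1)).
Proof. intro; apply is_derive_Reals, derivable_pt_lim_power; assumption. Qed.

(** * The function h3 as a difference of exponentials *)

(** The exponent -1/(1 + delta eta_bar) is expo - 1, so the first term is the derivative of x^expo
    at [xhat], that is, 2 delta / mu times its value there. *)
Lemma a_bar_eq (mu sigma delta theta : R) :
  0 < mu -> 0 < sigma -> 0 < delta ->
  a_bar mu sigma delta theta
  = Rpower (xhat mu sigma delta) (expo mu sigma delta) * (2 * delta / mu - theta).
Proof.
intros Hm Hs Hd; unfold a_bar.
pose proof (eta_bar_pos mu sigma Hm Hs).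
pose proof (xhat_pos mu sigma delta Hm Hs Hd).
replace (- 1 / (1 + delta * eta_bar mu sigma)) with (expo mu sigma delta - 1)
  by (unfold expo; field; nra).
rewrite Rpower_minus_1 by assumption.
rewrite (expo_div_xhat mu sigma delta Hm Hs Hd) at 1.
field; lra.
Qed.

(* [h3], [h3'] and [h3''] are proportional to [expdiff] at [n = 0, 1, 2]. *)
Definition expdiff (K p m : R) (n : nat) (x : R) : R :=
  (K - m) * p ^ n * exp (p * x) - (K - p) * m ^ n * exp (m * x).

Lemma is_derive_expdiff (K p m : R) (n : nat) (x : R) :
  is_derive (expdiff K p m n) x (expdiff K p m (S n) x).
Proof. unfold expdiff; auto_derive; [easy|simpl; ring]. Qed.

Definition h3_scale (mu sigma delta : R) : R :=
  Rpower (xhat mu sigma delta) (expo mu sigma delta)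
  / (theta_plus mu sigma delta - theta_minus mu sigma delta).

Definition h3_n (mu sigma delta : R) (n : nat) (x : R) : R :=
  h3_scale mu sigma delta
  * expdiff (2 * delta / mu) (theta_plus mu sigma delta)
      (theta_minus mu sigma delta) n x.

Lemma is_derive_h3_n (mu sigma delta : R) (n : nat) (x : R) :
  is_derive (h3_n mu sigma delta n) x (h3_n mu sigma delta (S n) x).
Proof. apply (is_derive_scal (expdiff _ _ _ n)), is_derive_expdiff. Qed.

Lemma h3_eq (mu sigma delta x : R) :
  0 < mu -> 0 < sigma -> 0 < delta -> h3 mu sigma delta x = h3_n mu sigma delta 0 x.
Proof.
intros Hm Hs Hd; unfold h3, h3_n, h3_scale, expdiff, a1_bar, a2_bar.
rewrite !a_bar_eq by assumption; unfold Rdiv; simpl; ring.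
Qed.

Lemma Derive_h3 (mu sigma delta x : R) :
  0 < mu -> 0 < sigma -> 0 < delta ->
  Derive (h3 mu sigma delta) x = h3_n mu sigma delta 1 x.
Proof.
intros Hm Hs Hd; apply is_derive_unique.
apply is_derive_ext with (h3_n mu sigma delta 0); [|apply is_derive_h3_n].
intro t; symmetry; apply h3_eq; assumption.
Qed.

Lemma h3_n_ode (mu sigma delta x : R) :
  0 < mu -> 0 < sigma -> 0 < delta ->
  sigma ^ 2 / 2 * h3_n mu sigma delta 2 x + mu * h3_n mu sigma delta 1 x
  = delta * h3_n mu sigma delta 0 x.
Proof.
intros Hm Hs Hd.
destruct (theta_plus_spec mu sigma delta Hm Hs Hd) as [_ P].
destruct (theta_minus_spec mu sigma delta Hm Hs Hd) as [_ M].
unfold quad in P, M; unfold h3_n, expdiff.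
set (p := theta_plus mu sigma delta) in *; set (m := theta_minus mu sigma delta) in *.
apply Rminus_diag_uniq.
transitivity (h3_scale mu sigma delta
  * ((2 * delta / mu - m) * exp (p * x) * (sigma ^ 2 / 2 * p ^ 2 + mu * p - delta)
     - (2 * delta / mu - p) * exp (m * x) * (sigma ^ 2 / 2 * m ^ 2 + mu * m - delta))).
- ring.
- rewrite P, M; ring.
Qed.

(** Drop the positive quadratic term from the equation of the root. In particular theta_+ < K = 2
    delta / mu, which makes the coefficients K - p and K - m of [expdiff] positive. *)
Lemma theta_plus_lt (mu sigma delta : R) :
  0 < mu -> 0 < sigma -> 0 < delta -> theta_plus mu sigma delta < delta / mu.
Proof.
intros Hm Hs Hd.
destruct (theta_plus_spec mu sigma delta Hm Hs Hd) as [P0 P1]; unfold quad in P1.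
apply Rmult_lt_reg_l with mu; [lra|].
replace (mu * (delta / mu)) with delta by (field; lra).
assert (0 < sigma ^ 2 / 2 * theta_plus mu sigma delta ^ 2); [|lra].
apply Rmult_lt_0_compat; [|apply pow_lt; lra].
assert (0 < sigma ^ 2) by (apply pow_lt; lra); lra.
Qed.

Lemma h3_scale_pos (mu sigma delta : R) :
  0 < mu -> 0 < sigma -> 0 < delta -> 0 < h3_scale mu sigma delta.
Proof.
intros Hm Hs Hd.
pose proof (proj1 (theta_plus_spec mu sigma delta Hm Hs Hd)).
pose proof (proj1 (theta_minus_spec mu sigma delta Hm Hs Hd)).
apply Rdiv_lt_0_compat; [apply exp_pos|lra].
Qed.

Lemma expdiff1_pos (K p m x : R) : m < 0 -> 0 < p < K -> 0 < expdiff K p m 1 x.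
Proof.
intros Hm Hp; unfold expdiff.
assert (0 < (K - m) * p ^ 1 * exp (p * x)).
{ apply Rmult_lt_0_compat; [nra|apply exp_pos]. }
assert (0 < (K - p) * (- m) * exp (m * x)).
{ apply Rmult_lt_0_compat; [nra|apply exp_pos]. }
lra.
Qed.

(** After factoring out exp(m x), the sign is that of (K - m) p^2 exp((p - m) x) - (K - p) m^2,
    which increases in x. *)
Lemma expdiff2_neg_before (K p m x b : R) :
  m < 0 -> 0 < p < K -> x <= b -> expdiff K p m 2 b < 0 -> expdiff K p m 2 x < 0.
Proof.
intros Hm Hp Hxb; unfold expdiff.
assert (Sp : forall t, exp (p * t) = exp ((p - m) * t) * exp (m * t)).
{ intro t; rewrite <- exp_plus; f_equal; ring. }
rewrite !Sp.
assert (He : exp ((p - m) * x) <= exp ((p - m) * b)).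
{ destruct Hxb as [Hxb| ->]; [left; apply exp_increasing; nra|right; reflexivity]. }
pose proof (exp_pos (m * x)); pose proof (exp_pos (m * b)).
assert (Hc : 0 < (K - m) * p ^ 2)
  by (apply Rmult_lt_0_compat; [lra|apply pow_lt; lra]).
intro H1.
assert (H2 : (K - m) * p ^ 2 * exp ((p - m) * b) - (K - p) * m ^ 2 < 0).
{ apply Rmult_lt_reg_r with (exp (m * b)); [assumption|]. lra. }
assert (H3 : (K - m) * p ^ 2 * exp ((p - m) * x) - (K - p) * m ^ 2 < 0) by nra.
nra.
Qed.

(** Both denominators are negative, so their product is positive. In the cross difference the pure p
    and pure m terms cancel, leaving a positive constant times exp(p y + m x) - exp(p x + m y). *)
Lemma expdiff_ratio_decreasing (K p m x y : R) :
  m < 0 -> 0 < p < K -> x < y -> expdiff K p m 2 y < 0 ->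
  expdiff K p m 1 y / expdiff K p m 2 y < expdiff K p m 1 x / expdiff K p m 2 x.
Proof.
intros Hm Hp Hxy Hy.
pose proof (expdiff2_neg_before K p m x y Hm Hp ltac:(lra) Hy) as Hx.
apply Rlt_0_minus.
replace (expdiff K p m 1 x / expdiff K p m 2 x - expdiff K p m 1 y / expdiff K p m 2 y)
  with ((expdiff K p m 1 x * expdiff K p m 2 y - expdiff K p m 1 y * expdiff K p m 2 x)
        / (expdiff K p m 2 x * expdiff K p m 2 y)) by (field; lra).
apply Rdiv_lt_0_compat; [|nra].
unfold expdiff.
replace (((K - m) * p ^ 1 * exp (p * x) - (K - p) * m ^ 1 * exp (m * x))
         * ((K - m) * p ^ 2 * exp (p * y) - (K - p) * m ^ 2 * exp (m * y))
         - ((K - m) * p ^ 1 * exp (p * y) - (K - p) * m ^ 1 * exp (m * y))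
           * ((K - m) * p ^ 2 * exp (p * x) - (K - p) * m ^ 2 * exp (m * x)))
  with ((K - m) * (K - p) * (p * (- m)) * (p - m)
        * (exp (p * y) * exp (m * x) - exp (p * x) * exp (m * y))) by ring.
rewrite <- !exp_plus.
assert (exp (p * x + m * y) < exp (p * y + m * x)) by (apply exp_increasing; nra).
repeat apply Rmult_lt_0_compat; lra.
Qed.

(** * Inverting [g4] *)

(** g4 b = y is linear in exp((p - m) b), with solution q, hence b = ln q / (p - m). The upper bound
    on y keeps 1 - y p positive. *)
Lemma g4_inv_spec (mu sigma delta y : R) :
  0 < mu -> 0 < sigma -> 0 < delta -> mu / (2 * delta) < y < mu / delta ->
  0 < g4_inv mu sigma delta y /\ g4 mu sigma delta (g4_inv mu sigma delta y) = y.
Proof.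
intros Hm Hs Hd Hy.
pose proof (h3_scale_pos mu sigma delta Hm Hs Hd) as Hc.
pose proof (theta_plus_lt mu sigma delta Hm Hs Hd) as Hpt.
destruct (theta_plus_spec mu sigma delta Hm Hs Hd) as [Hp _].
destruct (theta_minus_spec mu sigma delta Hm Hs Hd) as [Hn _].
apply (iota_correct (fun b : R => 0 < b /\ g4 mu sigma delta b = y)).
set (K := 2 * delta / mu).
assert (HK : delta / mu < K).
{ unfold K; assert (0 < delta / mu) by (apply Rdiv_lt_0_compat; lra); lra. }
assert (Hy1 : 1 < K * y).
{ replace 1 with (K * (mu / (2 * delta))) by (unfold K; field; lra).
  apply Rmult_lt_compat_l; lra. }
assert (Hy2 : y * (delta / mu) < 1).
{ replace 1 with (mu / delta * (delta / mu)) by (field; lra).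
  apply Rmult_lt_compat_r; lra. }
assert (Hy0 : 0 < y).
{ apply Rlt_trans with (mu / (2 * delta)); [apply Rdiv_lt_0_compat|]; lra. }
set (p := theta_plus mu sigma delta) in *.
set (m := theta_minus mu sigma delta) in *.
assert (D1 : 0 < 1 - y * p) by nra.
assert (D2 : 0 < 1 - y * m) by nra.
assert (DA : 0 < (K - m) * (1 - y * p)) by (apply Rmult_lt_0_compat; lra).
assert (DB : 0 < (K - p) * (1 - y * m)) by (apply Rmult_lt_0_compat; lra).
set (q := (K - p) * (1 - y * m) / ((K - m) * (1 - y * p))).
(* q > 1 amounts to K y (p - m) > p - m, that is, to y > mu / (2 delta); it makes b positive. *)
assert (Hq : 1 < q).
{ apply Rmult_lt_reg_r with ((K - m) * (1 - y * p)); [assumption|].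
  unfold q; field_simplify; try lra; nra. }
assert (G : forall b, g4 mu sigma delta b = y <-> exp ((p - m) * b) = q).
{ intro b; unfold g4; rewrite h3_eq, Derive_h3 by assumption.
  pose proof (expdiff1_pos K p m b Hn ltac:(lra)) as H1.
  unfold h3_n; fold K p m.
  replace (h3_scale mu sigma delta * expdiff K p m 0 b
           / (h3_scale mu sigma delta * expdiff K p m 1 b))
    with (expdiff K p m 0 b / expdiff K p m 1 b) by (field; lra).
  assert (E : expdiff K p m 0 b - y * expdiff K p m 1 b
              = (K - m) * (1 - y * p) * exp (m * b) * (exp ((p - m) * b) - q)).
  { unfold q, expdiff.
    replace (exp (p * b)) with (exp ((p - m) * b) * exp (m * b))
      by (rewrite <- exp_plus; f_equal; ring).
    field; lra. }
  pose proof (exp_pos (m * b)) as He.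
  split; intro H.
  - assert (E0 : expdiff K p m 0 b - y * expdiff K p m 1 b = 0)
      by (rewrite <- H; field; lra).
    rewrite E0 in E.
    symmetry in E; apply Rmult_integral in E; destruct E as [E|E]; [|lra].
    assert (0 < (K - m) * (1 - y * p) * exp (m * b)) by (apply Rmult_lt_0_compat; lra).
    lra.
  - rewrite H in E; apply Rmult_eq_reg_r with (expdiff K p m 1 b); [|lra].
    field_simplify; lra. }
exists (ln q / (p - m)); split.
- split.
  + apply Rdiv_lt_0_compat; [rewrite <- ln_1; apply ln_increasing|]; lra.
  + apply G; replace ((p - m) * (ln q / (p - m))) with (ln q) by (field; lra).
    apply exp_ln; lra.
- intros b [_ Hb]; apply G in Hb; change (ln q / (p - m) = b :> R).
  rewrite <- Hb, ln_exp; field; lra.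
Qed.

(** * Gluing two functions at a junction *)

Definition glue (a : R) (u w : R -> R) (x : R) : R :=
  if Rlt_dec x a then u x else w x.

Lemma glue_left (a : R) (u w : R -> R) (x : R) : x < a -> glue a u w x = u x.
Proof. unfold glue; destruct (Rlt_dec x a); lra. Qed.

Lemma glue_right (a : R) (u w : R -> R) (x : R) : a <= x -> glue a u w x = w x.
Proof. unfold glue; destruct (Rlt_dec x a); lra. Qed.

(** Each piece is controlled on a full neighbourhood of x as soon as x lies in the closure of its
    side. At x = a both controls hold on a common neighbourhood, and each t uses the one for its own
    side. *)
Lemma locally_glue (a : R) (u w : R -> R) (x : R) (P : R -> R -> Prop) :
  u a = w a ->
  (x <= a -> locally x (fun t => P t (u t))) ->
  (a <= x -> locally x (fun t => P t (w t))) ->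
  locally x (fun t => P t (glue a u w t)).
Proof.
intros E Hu Hw.
destruct (Rtotal_order x a) as [Hx|[Hx|Hx]].
- apply filter_imp with (fun t => t < a /\ P t (u t)).
  + intros t [Ht HP]; rewrite glue_left; assumption.
  + apply filter_and; [apply (open_lt a), Hx|apply Hu; lra].
- apply filter_imp with (fun t => P t (u t) /\ P t (w t)).
  + intros t [H1 H2]; unfold glue; destruct (Rlt_dec t a); assumption.
  + apply filter_and; [apply Hu|apply Hw]; lra.
- apply filter_imp with (fun t => a < t /\ P t (w t)).
  + intros t [Ht HP]; rewrite glue_right; [assumption|lra].
  + apply filter_and; [apply (open_gt a), Hx|apply Hw; lra].
Qed.

Lemma glue_sides (a : R) (u w : R -> R) (x : R) :
  u a = w a -> (x <= a -> glue a u w x = u x) /\ (a <= x -> glue a u w x = w x).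
Proof.
intro E; split; intro H; [|apply glue_right, H].
destruct H as [H|H]; [apply glue_left, H|rewrite H, glue_right; lra].
Qed.

(** Once values and derivatives at x are fixed, differentiability is a local estimate on the pairs
    (t, f t), so [locally_glue] applies to it. *)
Lemma is_derive_glue (a : R) (u w du dw : R -> R) (x : R) :
  u a = w a -> du a = dw a ->
  (x <= a -> is_derive u x (du x)) -> (a <= x -> is_derive w x (dw x)) ->
  is_derive (glue a u w) x (glue a du dw x).
Proof.
intros E0 E1 Hu Hw.
destruct (glue_sides a u w x E0) as [Gu Gw].
destruct (glue_sides a du dw x E1) as [Du Dw].
split; [apply is_linear_scal_l|].
intros z Hz eps.
(* The differential is quantified over limit points z of the filter; here z can only be x. *)
apply (is_filter_lim_locally_unique (V := AbsRing_NormedModule R_AbsRing)) in Hz.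
subst z.
apply (locally_glue a u w x (fun t r =>
  norm (minus (minus r (glue a u w x)) (scal (minus t x) (glue a du dw x)))
  <= eps * norm (minus t x)) E0).
- intro Hx; rewrite (Gu Hx), (Du Hx).
  destruct (Hu Hx) as [_ H]; apply (H x (fun P HP => HP) eps).
- intro Hx; rewrite (Gw Hx), (Dw Hx).
  destruct (Hw Hx) as [_ H]; apply (H x (fun P HP => HP) eps).
Qed.

Lemma continuous_glue (a : R) (u w : R -> R) (x : R) :
  u a = w a ->
  (x <= a -> continuous u x) -> (a <= x -> continuous w x) ->
  continuous (glue a u w) x.
Proof.
intros E Hu Hw P HP.
destruct (glue_sides a u w x E) as [Gu Gw].
apply (locally_glue a u w x (fun _ r => P r) E); intro Hx.
- apply (Hu Hx); rewrite <- (Gu Hx); exact HP.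
- apply (Hw Hx); rewrite <- (Gw Hx); exact HP.
Qed.

(** Points on opposite sides are compared through the common value at a. [D] bounds the left piece
    from below, by 0 or by an earlier junction, so that gluings can be nested. *)
Lemma glue_decreasing (a : R) (u w : R -> R) (D : R -> Prop) :
  u a = w a -> D a ->
  (forall x y, D x -> x < y <= a -> u y < u x) ->
  (forall x y, a <= x < y -> w y < w x) ->
  forall x y, D x -> x < y -> glue a u w y < glue a u w x.
Proof.
intros E Da Hu Hw x y Dx Hxy; unfold glue.
destruct (Rlt_dec x a), (Rlt_dec y a); try lra.
- apply Hu; [assumption|lra].
- apply Rle_lt_trans with (w a).
  + destruct (Rle_lt_or_eq_dec a y) as [H|H]; try lra.
    * left; apply Hw; lra.
    * rewrite H; lra.
  + rewrite <- E; apply Hu; [assumption|lra].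
- apply Hw; lra.
Qed.

(** * Monotonicity and concavity from derivatives; infima of half-lines *)

Lemma derive_neg_decreasing (f df : R -> R) :
  (forall x, 0 < x -> is_derive f x (df x)) -> (forall x, 0 < x -> df x < 0) ->
  decreasing_on_pos f.
Proof.
intros Hd Hn x y Hx Hxy.
destruct (MVT_cor2 f df x y Hxy) as [c [E Hc]].
- intros c Hc; apply is_derive_Reals, Hd; lra.
- pose proof (Hn c ltac:(lra)); nra.
Qed.

Lemma derive_pos_increasing (f df : R -> R) :
  (forall x, 0 < x -> is_derive f x (df x)) -> (forall x, 0 < x -> 0 < df x) ->
  increasing_on_pos f.
Proof.
intros Hd Hp x y Hx Hxy.
destruct (MVT_cor2 f df x y Hxy) as [c [E Hc]].
- intros c Hc; apply is_derive_Reals, Hd; lra.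
- pose proof (Hp c ltac:(lra)); nra.
Qed.

(** By the mean value theorem the graph lies below its tangents. Averaging the tangent at z = t x +
    (1 - t) y over x and y cancels the slope term. *)
Lemma derive_decreasing_concave (f df : R -> R) :
  (forall x, 0 < x -> is_derive f x (df x)) -> decreasing_on_pos df ->
  concave_on_pos f.
Proof.
intros Hd Hdec.
assert (Tan : forall x z, 0 < x -> 0 < z -> f x <= f z + df z * (x - z)).
{ intros x z Hx Hz.
  destruct (Rtotal_order x z) as [H|[->|H]]; [|lra|].
  - destruct (MVT_cor2 f df x z H) as [c [E Hc]].
    + intros c Hc; apply is_derive_Reals, Hd; lra.
    + pose proof (Hdec c z ltac:(lra) ltac:(lra)); nra.
  - destruct (MVT_cor2 f df z x H) as [c [E Hc]].
    + intros c Hc; apply is_derive_Reals, Hd; lra.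
    + pose proof (Hdec z c ltac:(lra) ltac:(lra)); nra. }
intros x y t Hx Hy Ht.
set (z := t * x + (1 - t) * y).
assert (Hz : 0 < z) by (unfold z; destruct (Req_dec t 0) as [->|]; nra).
pose proof (Tan x z Hx Hz) as Tx; pose proof (Tan y z Hy Hz) as Ty.
assert (t * f x <= t * (f z + df z * (x - z)))
  by (apply Rmult_le_compat_l; lra).
assert ((1 - t) * f y <= (1 - t) * (f z + df z * (y - z)))
  by (apply Rmult_le_compat_l; lra).
assert (t * (x - z) + (1 - t) * (y - z) = 0) by (unfold z; ring).
nra.
Qed.

Lemma Glb_Rbar_gt (P : R -> Prop) (b : R) :
  (forall x, P x <-> b < x) -> Glb_Rbar P = Finite b.
Proof.
intro H; apply is_glb_Rbar_unique; split.
- intros x Hx; apply H in Hx; simpl; lra.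
- intros [r| |] Hr; simpl; [| |exact I].
  + apply Rnot_lt_le; intro Hb.
    (* A lower bound r > b fails at the midpoint of b and r, which satisfies P. *)
    pose proof (Hr ((b + r) / 2)) as H1; simpl in H1.
    assert (r <= (b + r) / 2); [apply H1, H; lra|lra].
  + apply (Hr (b + 1)), H; lra.
Qed.

Lemma Glb_Rbar_min (P : R -> Prop) (b : R) :
  P b -> (forall x, P x -> b <= x) -> Glb_Rbar P = Finite b.
Proof.
intros Hb H; apply is_glb_Rbar_unique; split; [exact H|].
intros r Hr; apply (Hr b Hb).
Qed.

(** * Derivatives of the power piece and of the last piece *)

(** The n-th derivative of x^p, namely p (p - 1) ... (p - n + 1) x^(p - n). *)
Fixpoint power_n (p : R) (n : nat) (x : R) : R :=
  match n with
  | O => Rpower x p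
  | S n => p * power_n (p - 1) n x
  end.

Lemma is_derive_power_n (p : R) (n : nat) (x : R) :
  0 < x -> is_derive (power_n p n) x (power_n p (S n) x).
Proof.
intro Hx; revert p; induction n as [|n IH]; intro p.
- apply is_derive_Rpower_l, Hx.
- apply (is_derive_scal (power_n (p - 1) n)), IH.
Qed.

(** The n-th derivative of A exp(l x) + k (x + r). *)
Definition tail_n (l A k r : R) (n : nat) (x : R) : R :=
  A * (l ^ n * exp (l * x))
  + match n with O => k * (x + r) | S O => k | _ => 0 end.

Lemma is_derive_tail_n (l A k r : R) (n : nat) (x : R) :
  is_derive (tail_n l A k r n) x (tail_n l A k r (S n) x).
Proof.
unfold tail_n; destruct n as [|[|n]]; auto_derive; try easy; simpl; ring.
Qed.

Lemma is_derive_shift (f : R -> R) (a x d : R) :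
  is_derive f (x - a) d -> is_derive (fun t => f (t - a)) x d.
Proof.
intro H; replace d with (1 * d) by ring.
apply (is_derive_comp f (fun t => t - a)); [exact H|].
auto_derive; [easy|ring].
Qed.

(** * The coefficients at the chosen level b2 *)

(** Collects what the choice of b2 and gamma > gamma1_bar provide, so that the analysis of v is free
    of [g4_inv]. *)
Definition admissible (mu sigma delta gamma b2 : R) : Prop :=
  (0 < mu /\ 0 < sigma /\ 0 < delta /\ 0 < gamma) /\
  xhat mu sigma delta < b2 /\
  g4 mu sigma delta (b2 - xhat mu sigma delta) = f1 mu sigma delta gamma /\
  f1 mu sigma delta gamma < mu / delta.

Lemma h3_n1_pos (mu sigma delta x : R) :
  0 < mu -> 0 < sigma -> 0 < delta -> 0 < h3_n mu sigma delta 1 x.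
Proof.
intros Hm Hs Hd; apply Rmult_lt_0_compat; [apply h3_scale_pos; assumption|].
pose proof (theta_plus_lt mu sigma delta Hm Hs Hd).
assert (0 < delta / mu) by (apply Rdiv_lt_0_compat; lra).
apply expdiff1_pos; [apply theta_minus_spec; assumption|].
split; [apply theta_plus_spec; assumption|lra].
Qed.

Lemma f1_eq (mu sigma delta gamma : R) :
  0 < delta -> 0 < gamma -> lambda mu sigma delta gamma < 0 ->
  f1 mu sigma delta gamma
  = / lambda mu sigma delta gamma + mu * gamma / (delta * (delta + gamma)).
Proof. intros; unfold f1; field; lra. Qed.

(** The condition on [g4] reads h3 = f1 h3' at b2 - xhat. With it the denominator of [c41] becomes
    h3' times its numerator, and this numerator is positive because [lambda] < 0. *)
Lemma coefficients (mu sigma delta gamma b2 : R) :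
  admissible mu sigma delta gamma b2 ->
  c41 mu sigma delta gamma b2
    * h3_n mu sigma delta 1 (b2 - xhat mu sigma delta) = 1 /\
  c41 mu sigma delta gamma b2
    * h3_n mu sigma delta 0 (b2 - xhat mu sigma delta) = f1 mu sigma delta gamma /\
  c42 mu sigma delta gamma b2
    = delta / ((delta + gamma) * lambda mu sigma delta gamma).
Proof.
intros [[Hm [Hs [Hd Hg]]] [_ [G _]]].
pose proof (h3_n1_pos mu sigma delta (b2 - xhat mu sigma delta) Hm Hs Hd) as H1.
destruct (lambda_spec mu sigma delta gamma Hm Hs Hd Hg) as [L0 _].
unfold g4 in G; rewrite h3_eq, Derive_h3 in G by assumption.
assert (H0 : h3_n mu sigma delta 0 (b2 - xhat mu sigma delta)
             = f1 mu sigma delta gamma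
               * h3_n mu sigma delta 1 (b2 - xhat mu sigma delta))
  by (rewrite <- G; field; lra).
rewrite f1_eq in * by assumption.
assert (C1 : c41 mu sigma delta gamma b2
             = / h3_n mu sigma delta 1 (b2 - xhat mu sigma delta)).
{ unfold c41; rewrite h3_eq, Derive_h3 by assumption; rewrite H0.
  set (l := lambda mu sigma delta gamma) in *.
  set (h := h3_n mu sigma delta 1 _) in *.
  assert (mu * gamma * l < 0) by (assert (0 < mu * gamma) by nra; nra).
  replace (h - l * delta / (gamma + delta)
               * ((/ l + mu * gamma / (delta * (delta + gamma))) * h))
    with (h * (gamma / (gamma + delta) - mu * gamma * l / (delta + gamma) ^ 2))
    by (field; lra).
  assert (0 < gamma / (gamma + delta)) by (apply Rdiv_lt_0_compat; lra).
  assert (0 < - (mu * gamma * l) / (delta + gamma) ^ 2)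
    by (apply Rdiv_lt_0_compat; [|apply pow_lt]; lra).
  set (k := gamma / (gamma + delta) - mu * gamma * l / (delta + gamma) ^ 2).
  assert (0 < k) by (unfold k, Rdiv in *; lra).
  field; lra. }
assert (C0 : c41 mu sigma delta gamma b2
             * h3_n mu sigma delta 0 (b2 - xhat mu sigma delta)
             = / lambda mu sigma delta gamma + mu * gamma / (delta * (delta + gamma)))
  by (rewrite C1, H0; field; lra).
split; [rewrite C1; field; lra|split; [exact C0|]].
unfold c42; rewrite h3_eq by assumption.
rewrite Rmult_assoc, C0; field; lra.
Qed.

Lemma c41_pos (mu sigma delta gamma b2 : R) :
  admissible mu sigma delta gamma b2 -> 0 < c41 mu sigma delta gamma b2.
Proof.
intro H; destruct (coefficients _ _ _ _ _ H) as [C1 _].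
destruct H as [[Hm [Hs [Hd _]]] _].
pose proof (h3_n1_pos mu sigma delta (b2 - xhat mu sigma delta) Hm Hs Hd).
nra.
Qed.

Lemma c42_neg (mu sigma delta gamma b2 : R) :
  admissible mu sigma delta gamma b2 -> c42 mu sigma delta gamma b2 < 0.
Proof.
intro H; destruct (coefficients _ _ _ _ _ H) as [_ [_ ->]].
destruct H as [[Hm [Hs [Hd Hg]]] _].
pose proof (proj1 (lambda_spec mu sigma delta gamma Hm Hs Hd Hg)).
apply Rdiv_pos_neg; nra.
Qed.

(* Concavity on the middle piece: by [h3_n_ode], [f1 < mu / delta] says exactly
   that [h3'' < 0] at its right end, and the sign of [h3''] changes only once. *)
Lemma h3_n2_neg (mu sigma delta gamma b2 x : R) :
  admissible mu sigma delta gamma b2 -> x <= b2 - xhat mu sigma delta ->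
  h3_n mu sigma delta 2 x < 0.
Proof.
intros [[Hm [Hs [Hd Hg]]] [_ [G F]]] Hx.
pose proof (h3_n1_pos mu sigma delta (b2 - xhat mu sigma delta) Hm Hs Hd) as H1.
pose proof (h3_n_ode mu sigma delta (b2 - xhat mu sigma delta) Hm Hs Hd) as O.
unfold g4 in G; rewrite h3_eq, Derive_h3 in G by assumption.
assert (H0 : delta * h3_n mu sigma delta 0 (b2 - xhat mu sigma delta)
             < mu * h3_n mu sigma delta 1 (b2 - xhat mu sigma delta)).
{ replace (h3_n mu sigma delta 0 (b2 - xhat mu sigma delta))
    with (f1 mu sigma delta gamma * h3_n mu sigma delta 1 (b2 - xhat mu sigma delta))
    by (rewrite <- G; field; lra).
  assert (delta * f1 mu sigma delta gamma < mu).
  { replace mu with (delta * (mu / delta)) at 2 by (field; lra).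
    apply Rmult_lt_compat_l; lra. }
  nra. }
pose proof (h3_scale_pos mu sigma delta Hm Hs Hd) as Sc.
pose proof (pow_lt sigma 2 Hs).
assert (N : h3_n mu sigma delta 2 (b2 - xhat mu sigma delta) < 0) by nra.
pose proof (theta_plus_lt mu sigma delta Hm Hs Hd).
assert (0 < delta / mu) by (apply Rdiv_lt_0_compat; lra).
unfold h3_n in *.
assert (N2 : expdiff (2 * delta / mu) (theta_plus mu sigma delta)
  (theta_minus mu sigma delta) 2 (b2 - xhat mu sigma delta) < 0) by nra.
apply expdiff2_neg_before with (x := x) in N2; [nra| | |exact Hx].
- apply theta_minus_spec; assumption.
- split; [apply theta_plus_spec; assumption|lra].
Qed.

(** * Second-order matching at the two junctions *)

(** At 0, [expdiff] is p - m for n = 0 and K (p - m) for n = 1, with K the logarithmic derivative of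
    x^expo at [xhat]. For n = 2 the ODE gives sigma^2 h3'' / 2 = - delta xhat^expo, and [xhat_mul]
    gives the same for the power. *)
Lemma h3_n_0 (mu sigma delta : R) (n : nat) :
  0 < mu -> 0 < sigma -> 0 < delta -> (n <= 2)%nat ->
  h3_n mu sigma delta n 0
  = power_n (expo mu sigma delta) n (xhat mu sigma delta).
Proof.
intros Hm Hs Hd Hn.
pose proof (xhat_pos mu sigma delta Hm Hs Hd) as Hx.
pose proof (pow_lt sigma 2 Hs) as Hs2.
pose proof (expo_div_xhat mu sigma delta Hm Hs Hd) as Ex.
pose proof (xhat_mul mu sigma delta Hm Hs Hd) as Xm.
pose proof (proj1 (theta_plus_spec mu sigma delta Hm Hs Hd)) as Hp.
pose proof (proj1 (theta_minus_spec mu sigma delta Hm Hs Hd)) as Hn'.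
assert (H0 : h3_n mu sigma delta 0 0
             = Rpower (xhat mu sigma delta) (expo mu sigma delta)).
{ unfold h3_n, h3_scale, expdiff; rewrite !Rmult_0_r, exp_0; simpl; field; lra. }
assert (H1 : h3_n mu sigma delta 1 0
             = 2 * delta / mu * Rpower (xhat mu sigma delta) (expo mu sigma delta)).
{ unfold h3_n, h3_scale, expdiff; rewrite !Rmult_0_r, exp_0; simpl; field; lra. }
destruct n as [|[|[|n]]]; [exact H0| | |exfalso; repeat apply le_S_n in Hn; inversion Hn].
- rewrite H1; simpl; rewrite Rpower_minus_1 by assumption.
  rewrite Ex at 2; field; lra.
- pose proof (h3_n_ode mu sigma delta 0 Hm Hs Hd) as O; rewrite H0, H1 in O.
  apply Rmult_eq_reg_l with (sigma ^ 2 / 2); [|lra].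
  simpl power_n; rewrite !Rpower_minus_1 by assumption.
  set (P := Rpower _ _) in *.
  replace (sigma ^ 2 / 2 * (expo mu sigma delta * ((expo mu sigma delta - 1)
            * (P / xhat mu sigma delta / xhat mu sigma delta))))
    with (- (sigma ^ 2 * (1 - expo mu sigma delta)) * expo mu sigma delta * P
          / (2 * xhat mu sigma delta ^ 2)) by (field; lra).
  rewrite <- Xm, Ex.
  replace (- (xhat mu sigma delta * mu) * (2 * delta / mu * xhat mu sigma delta) * P
           / (2 * xhat mu sigma delta ^ 2)) with (- delta * P) by (field; lra).
  apply Rplus_eq_reg_r with (mu * (2 * delta / mu * P)); rewrite O; field; lra.
Qed.

Definition tail (mu sigma delta gamma b2 : R) (n : nat) (x : R) : R :=
  tail_n (lambda mu sigma delta gamma) (c42 mu sigma delta gamma b2)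
    (gamma / (gamma + delta))
    (c41 mu sigma delta gamma b2 * h3 mu sigma delta (b2 - xhat mu sigma delta)
     + mu / (delta + gamma)) n (x - b2).

(** The common values are f1 gamma for n = 0 and 1 for n = 1. For n = 2, the ODE on the left and the
    equation of [lambda] on the right both give sigma^2 v'' / 2 = delta f1 - mu. *)
Lemma tail_b2 (mu sigma delta gamma b2 : R) (n : nat) :
  admissible mu sigma delta gamma b2 -> (n <= 2)%nat ->
  c41 mu sigma delta gamma b2
    * h3_n mu sigma delta n (b2 - xhat mu sigma delta)
  = tail mu sigma delta gamma b2 n b2.
Proof.
intros H Hn; destruct (coefficients _ _ _ _ _ H) as [C1 [C0 C2]].
destruct H as [[Hm [Hs [Hd Hg]]] _].
pose proof (pow_lt sigma 2 Hs) as Hs2.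
destruct (lambda_spec mu sigma delta gamma Hm Hs Hd Hg) as [L0 L1].
unfold tail, tail_n; rewrite h3_eq, C0, C2 by assumption.
replace (b2 - b2) with 0 by ring; rewrite Rmult_0_r, exp_0.
destruct n as [|[|[|n]]]; [| | |exfalso; repeat apply le_S_n in Hn; inversion Hn].
- rewrite C0, f1_eq by assumption; simpl; field; lra.
- rewrite C1; simpl; field; lra.
- pose proof (h3_n_ode mu sigma delta (b2 - xhat mu sigma delta) Hm Hs Hd) as O.
  rewrite f1_eq in C0 by assumption.
  set (h := h3_n mu sigma delta) in *; set (c := c41 _ _ _ _ _) in *.
  set (l := lambda mu sigma delta gamma) in *.
  set (b := b2 - xhat mu sigma delta) in *.
  unfold quad in L1.
  apply Rmult_eq_reg_l with (sigma ^ 2 / 2); [|lra].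
  assert (E : sigma ^ 2 / 2 * (c * h 2%nat b)
              = delta * (c * h 0%nat b) - mu * (c * h 1%nat b))
    by (transitivity (c * (sigma ^ 2 / 2 * h 2%nat b)); [ring|];
        replace (sigma ^ 2 / 2 * h 2%nat b)
          with (delta * h 0%nat b - mu * h 1%nat b) by lra; ring).
  rewrite E, C0, C1.
  replace (sigma ^ 2 / 2 * (delta / ((delta + gamma) * l) * (l ^ 2 * 1) + 0))
    with (delta / ((delta + gamma) * l) * (sigma ^ 2 / 2 * l ^ 2)) by ring.
  replace (sigma ^ 2 / 2 * l ^ 2) with (delta + gamma - mu * l) by lra.
  field; lra.
Qed.

(* The [n]-th derivative of [vfun] on the positive half-line, for [n <= 2]. *)
Definition vfun_n (mu sigma delta gamma b2 : R) (n : nat) : R -> R :=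
  glue (xhat mu sigma delta)
    (fun x => c41 mu sigma delta gamma b2 * power_n (expo mu sigma delta) n x)
    (glue b2
      (fun x => c41 mu sigma delta gamma b2
                * h3_n mu sigma delta n (x - xhat mu sigma delta))
      (tail mu sigma delta gamma b2 n)).

Lemma join_xhat (mu sigma delta gamma b2 : R) (n : nat) (w : R -> R) :
  admissible mu sigma delta gamma b2 -> (n <= 2)%nat ->
  c41 mu sigma delta gamma b2
    * power_n (expo mu sigma delta) n (xhat mu sigma delta)
  = glue b2
      (fun x => c41 mu sigma delta gamma b2
                * h3_n mu sigma delta n (x - xhat mu sigma delta)) w
      (xhat mu sigma delta).
Proof.
intros [[Hm [Hs [Hd Hg]]] [Hb _]] Hn.
rewrite glue_left by assumption.
replace (xhat mu sigma delta - xhat mu sigma delta) with 0 by ring.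
rewrite h3_n_0 by assumption; reflexivity.
Qed.

(** * Derivatives of v and their signs *)

Lemma vfun_n_0 (mu sigma delta gamma b2 x : R) :
  admissible mu sigma delta gamma b2 -> 0 < x ->
  vfun mu sigma delta gamma b2 x = vfun_n mu sigma delta gamma b2 0 x.
Proof.
intros H Hx; pose proof (tail_b2 _ _ _ _ _ 0 H (le_S _ _ (le_S _ _ (le_n 0)))) as T.
destruct H as [[Hm [Hs [Hd Hg]]] _].
unfold vfun, vfun_n, glue.
destruct (Rle_dec x 0); [lra|].
destruct (Rlt_dec x (xhat mu sigma delta)); [reflexivity|].
destruct (Rle_dec x b2), (Rlt_dec x b2); try lra.
- rewrite h3_eq by assumption; reflexivity.
(* [vfun] assigns b2 to the middle branch and [glue] to the right one; [tail_b2] reconciles them. *)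
- replace x with b2 by lra; rewrite <- T, h3_eq by assumption; reflexivity.
- unfold tail, tail_n; simpl; ring.
Qed.

Lemma is_derive_vfun_n (mu sigma delta gamma b2 : R) (n : nat) (x : R) :
  admissible mu sigma delta gamma b2 -> (n <= 1)%nat -> 0 < x ->
  is_derive (vfun_n mu sigma delta gamma b2 n) x
    (vfun_n mu sigma delta gamma b2 (S n) x).
Proof.
intros H Hn Hx.
apply is_derive_glue.
- apply join_xhat; [exact H|apply le_S, Hn].
- apply join_xhat; [exact H|apply le_n_S, Hn].
- intros _; apply (is_derive_scal (power_n (expo mu sigma delta) n)).
  apply is_derive_power_n, Hx.
- intros _; apply is_derive_glue.
  + apply tail_b2; [exact H|apply le_S, Hn].
  + apply tail_b2; [exact H|apply le_n_S, Hn].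
  + intros _.
    apply (is_derive_scal (fun t => h3_n mu sigma delta n (t - xhat mu sigma delta))).
    apply is_derive_shift, is_derive_h3_n.
  + intros _; apply (is_derive_shift (tail_n _ _ _ _ n)), is_derive_tail_n.
Qed.

(** Each piece is smooth, so its second derivative is continuous by being differentiable; the
    junction values agree. *)
Lemma continuous_vfun_2 (mu sigma delta gamma b2 x : R) :
  admissible mu sigma delta gamma b2 -> 0 < x ->
  continuous (vfun_n mu sigma delta gamma b2 2) x.
Proof.
intros H Hx.
apply continuous_glue; [apply join_xhat; [exact H|apply le_n]| |].
- intros _; apply (ex_derive_continuous (fun t => _ * power_n _ 2 t)).
  eexists; apply (is_derive_scal (power_n (expo mu sigma delta) 2)).
  apply is_derive_power_n, Hx.
- intros _; apply continuous_glue; [apply tail_b2; [exact H|apply le_n]| |].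
  + intros _; apply (ex_derive_continuous (fun t => _ * h3_n _ _ _ 2 (t - _))).
    eexists.
    apply (is_derive_scal (fun t => h3_n mu sigma delta 2 (t - xhat mu sigma delta))).
    apply is_derive_shift, is_derive_h3_n.
  + intros _; apply (ex_derive_continuous (tail _ _ _ _ _ 2)).
    eexists; apply (is_derive_shift (tail_n _ _ _ _ 2)), is_derive_tail_n.
Qed.

(** On the last piece [c42] and [lambda] are both negative, so the exponential term has a positive
    derivative. *)
Lemma vfun_1_pos (mu sigma delta gamma b2 x : R) :
  admissible mu sigma delta gamma b2 -> 0 < vfun_n mu sigma delta gamma b2 1 x.
Proof.
intro H; pose proof (c41_pos _ _ _ _ _ H) as Hc.
pose proof (c42_neg _ _ _ _ _ H) as Hc2.
destruct H as [[Hm [Hs [Hd Hg]]] _].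
pose proof (proj1 (lambda_spec mu sigma delta gamma Hm Hs Hd Hg)) as L0.
unfold vfun_n, glue.
destruct (Rlt_dec x (xhat mu sigma delta)); [|destruct (Rlt_dec x b2)].
- apply Rmult_lt_0_compat; [exact Hc|].
  apply Rmult_lt_0_compat; [apply expo_bounds; assumption|apply exp_pos].
- apply Rmult_lt_0_compat; [exact Hc|apply h3_n1_pos; assumption].
- unfold tail, tail_n; rewrite pow_1.
  assert (0 < gamma / (gamma + delta)) by (apply Rdiv_lt_0_compat; lra).
  pose proof (exp_pos (lambda mu sigma delta gamma * (x - b2))).
  assert (0 < c42 mu sigma delta gamma b2 * lambda mu sigma delta gamma) by nra.
  nra.
Qed.

(** Negativity comes from expo < 1 on the first piece, from [h3_n2_neg] on the second and from [c42]
    < 0 on the third. *)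
Lemma vfun_2_neg (mu sigma delta gamma b2 x : R) :
  admissible mu sigma delta gamma b2 -> vfun_n mu sigma delta gamma b2 2 x < 0.
Proof.
intro H; pose proof (c41_pos _ _ _ _ _ H) as Hc.
pose proof (c42_neg _ _ _ _ _ H) as Hc2.
pose proof (fun t => h3_n2_neg _ _ _ _ _ t H) as N.
destruct H as [[Hm [Hs [Hd Hg]]] _].
pose proof (proj1 (lambda_spec mu sigma delta gamma Hm Hs Hd Hg)) as L0.
unfold vfun_n, glue.
destruct (Rlt_dec x (xhat mu sigma delta)); [|destruct (Rlt_dec x b2)].
- pose proof (expo_bounds mu sigma delta Hm Hs Hd); simpl power_n.
  assert (0 < Rpower x (expo mu sigma delta - 1 - 1)) by apply exp_pos.
  assert (0 < c41 mu sigma delta gamma b2 * expo mu sigma delta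
              * ((1 - expo mu sigma delta) * Rpower x (expo mu sigma delta - 1 - 1)))
    by (apply Rmult_lt_0_compat; apply Rmult_lt_0_compat; lra).
  lra.
- specialize (N (x - xhat mu sigma delta) ltac:(lra)); nra.
- unfold tail, tail_n; rewrite Rplus_0_r.
  assert (0 < lambda mu sigma delta gamma ^ 2
              * exp (lambda mu sigma delta gamma * (x - b2))); [|nra].
  apply Rmult_lt_0_compat; [apply pow2_gt_0; lra|apply exp_pos].
Qed.

(** * Monotonicity of v'/v'' *)

Lemma power_ratio (c p x : R) :
  0 < c -> 0 < x -> 0 < p < 1 ->
  c * power_n p 1 x / (c * power_n p 2 x) = x / (p - 1).
Proof.
intros Hc Hx Hp; simpl; rewrite (Rpower_minus_1 x (p - 1)) by assumption.
pose proof (exp_pos ((p - 1) * ln x)) as He.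
unfold Rpower; field; lra.
Qed.

Lemma tail_ratio_decreasing (mu sigma delta gamma b2 x y : R) :
  admissible mu sigma delta gamma b2 -> x < y ->
  tail mu sigma delta gamma b2 1 y / tail mu sigma delta gamma b2 2 y
  < tail mu sigma delta gamma b2 1 x / tail mu sigma delta gamma b2 2 x.
Proof.
intros H Hxy; pose proof (c42_neg _ _ _ _ _ H) as Hc2.
destruct H as [[Hm [Hs [Hd Hg]]] _].
pose proof (proj1 (lambda_spec mu sigma delta gamma Hm Hs Hd Hg)) as L0.
unfold tail, tail_n.
assert (Hk : 0 < gamma / (gamma + delta)) by (apply Rdiv_lt_0_compat; lra).
set (l := lambda _ _ _ _) in *; set (A := c42 _ _ _ _ _) in *.
set (k := gamma / (gamma + delta)) in *.
assert (S : forall t, (A * (l ^ 1 * exp (l * (t - b2))) + k)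
                      / (A * (l ^ 2 * exp (l * (t - b2))) + 0)
                      = / l + k / (A * l ^ 2) * exp (- (l * (t - b2)))).
{ intro t; pose proof (exp_pos (l * (t - b2))); rewrite exp_Ropp; field; lra. }
rewrite !S.
assert (exp (- (l * (x - b2))) < exp (- (l * (y - b2))))
  by (apply exp_increasing; nra).
assert (0 < l ^ 2) by (apply pow2_gt_0; lra).
(* A = [c42] < 0, so the increasing exponential has a negative coefficient. *)
assert (k / (A * l ^ 2) < 0) by (apply Rdiv_pos_neg; nra).
nra.
Qed.

Lemma h3_ratio_decreasing (mu sigma delta gamma b2 x y : R) :
  admissible mu sigma delta gamma b2 ->
  x < y -> y <= b2 - xhat mu sigma delta ->
  c41 mu sigma delta gamma b2 * h3_n mu sigma delta 1 y
  / (c41 mu sigma delta gamma b2 * h3_n mu sigma delta 2 y)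
  < c41 mu sigma delta gamma b2 * h3_n mu sigma delta 1 x
    / (c41 mu sigma delta gamma b2 * h3_n mu sigma delta 2 x).
Proof.
intros H Hxy Hy; pose proof (c41_pos _ _ _ _ _ H) as Hc.
pose proof (h3_n2_neg _ _ _ _ _ x H ltac:(lra)) as Nx.
pose proof (h3_n2_neg _ _ _ _ _ y H Hy) as Ny.
destruct H as [[Hm [Hs [Hd Hg]]] _].
pose proof (h3_scale_pos mu sigma delta Hm Hs Hd) as Sc.
pose proof (theta_plus_lt mu sigma delta Hm Hs Hd).
assert (0 < delta / mu) by (apply Rdiv_lt_0_compat; lra).
unfold h3_n in *.
set (e := expdiff _ _ _) in *.
assert (Ex : e 2%nat x < 0) by nra.
assert (Ey : e 2%nat y < 0) by nra.
assert (S : forall t, e 2%nat t < 0 ->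
  c41 mu sigma delta gamma b2 * (h3_scale mu sigma delta * e 1%nat t)
  / (c41 mu sigma delta gamma b2 * (h3_scale mu sigma delta * e 2%nat t))
  = e 1%nat t / e 2%nat t) by (intros t Ht; field; lra).
rewrite !S by assumption.
apply expdiff_ratio_decreasing; try assumption.
- apply theta_minus_spec; assumption.
- split; [apply theta_plus_spec; assumption|lra].
Qed.

Lemma glue_div (a : R) (u1 w1 u2 w2 : R -> R) (x : R) :
  glue a u1 w1 x / glue a u2 w2 x
  = glue a (fun t => u1 t / u2 t) (fun t => w1 t / w2 t) x.
Proof. unfold glue; destruct (Rlt_dec x a); reflexivity. Qed.

(** The quotient of glued functions is the glued quotient, and its pieces agree at each junction
    because first and second derivatives do. The gluing at [xhat] is treated first, then the one at
    b2. *)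
Lemma vfun_ratio_decreasing (mu sigma delta gamma b2 : R) :
  admissible mu sigma delta gamma b2 ->
  decreasing_on_pos (fun x => vfun_n mu sigma delta gamma b2 1 x
                              / vfun_n mu sigma delta gamma b2 2 x).
Proof.
intros H x y Hx Hxy; unfold vfun_n; rewrite !glue_div.
pose proof (c41_pos _ _ _ _ _ H) as Hc.
pose proof (proj1 H) as [Hm [Hs [Hd Hg]]].
pose proof (expo_bounds mu sigma delta Hm Hs Hd) as Hp.
apply (glue_decreasing _ _ _ (fun t => 0 < t)); try assumption.
- rewrite <- !join_xhat; try assumption; try apply le_n; try apply le_S, le_n.
  reflexivity.
- apply xhat_pos; assumption.
- intros s t Hs0 Hst; rewrite !power_ratio by lra.
  assert (/ (expo mu sigma delta - 1) < 0) by (apply Rinv_lt_0_compat; lra).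
  unfold Rdiv; nra.
- intros s t Hst; rewrite !glue_div.
  apply (glue_decreasing _ _ _ (fun t => xhat mu sigma delta <= t)); try lra.
  + rewrite <- !tail_b2; try assumption; try apply le_n; try apply le_S, le_n.
    reflexivity.
  + destruct H as [_ [H _]]; lra.
  + intros; apply h3_ratio_decreasing; [assumption|lra|lra].
  + intros; apply tail_ratio_decreasing; [assumption|lra].
Qed.

(** * Verification of the stated properties of v *)

Theorem proposition3p13 :
  forall (mu sigma delta gamma : R),
  0 < mu -> 0 < sigma -> 0 < delta -> 0 < gamma ->
  gamma1_bar mu sigma delta < gamma ->
  let b1 := xhat mu sigma delta in
  let b2 := xhat mu sigma delta
            + g4_inv mu sigma delta
                (1 / (lambda mu sigma delta gamma * delta)
                 * (delta + lambda mu sigma delta gamma * mu * gamma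
                            / (delta + gamma))) in
  let v := vfun mu sigma delta gamma b2 in
  let v' := Derive v in
  let v'' := Derive_n v 2 in
  (* b2 is also the first point where v' drops below 1 *)
  Glb_Rbar (fun x => 0 < x /\ v' x < 1) = Finite b2 /\
  C2_on_pos v /\ increasing_on_pos v /\ concave_on_pos v /\
  (* makes the quotients by v'' below meaningful *)
  (forall x, 0 < x -> v'' x <> 0) /\
  (forall x, 0 < x < b1 ->
     - (mu ^ 2 * (v' x) ^ 2 / (2 * sigma ^ 2 * v'' x)) - delta * v x
     + gamma * (x - b2 + v b2 - v x) * indicator_gt b2 x = 0) /\
  (forall x, b1 < x ->
     1 / 2 * sigma ^ 2 * v'' x + mu * v' x - delta * v x
     + gamma * (x - b2 + v b2 - v x) * indicator_gt b2 x = 0) /\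
  v 0 = 0 /\
  decreasing_on_pos (fun x => v' x / v'' x) /\
  (exists l : R,
     filterlim (fun x => mu / sigma ^ 2 * (v' x / v'' x)) (at_right 0) (locally l)
     /\ -1 < l) /\
  Glb_Rbar (fun x => 0 < x /\ - (mu / sigma ^ 2 * (v' x / v'' x)) >= 1)
    = Finite b1.
Proof.
intros mu sigma delta gamma Hm Hs Hd Hg Hgg b1.
fold (f1 mu sigma delta gamma); intros b2 v v' v''.
pose proof (f1_bounds mu sigma delta gamma Hm Hs Hd Hg Hgg) as F.
destruct (g4_inv_spec mu sigma delta _ Hm Hs Hd F) as [B0 B1].
assert (H : admissible mu sigma delta gamma b2).
{ split; [easy|]; unfold b2; split; [lra|split; [|lra]].
  etransitivity; [|exact B1]; f_equal; ring. }
assert (Hb : b1 < b2) by (unfold b1, b2; lra).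
(* From here on b2 is known only through [admissible] and b1 < b2. *)
clear F B0 B1; clearbody b2.
assert (Hx : 0 < b1) by (apply xhat_pos; assumption).
pose proof (expo_bounds mu sigma delta Hm Hs Hd) as Hp.
pose proof (c41_pos _ _ _ _ _ H) as Hc.
pose proof (pow_lt sigma 2 Hs) as Hs2.
set (V := vfun_n mu sigma delta gamma b2).
(* v and V agree only for positive arguments; as the half-line is open, this suffices to transfer
   derivatives. *)
assert (Near : forall x (P : R -> Prop),
  0 < x -> (forall t, 0 < t -> P t) -> locally x P).
{ intros x P H0 HP; apply filter_imp with (Rlt 0); [exact HP|apply (open_gt 0), H0]. }
assert (V0 : forall x, 0 < x -> v x = V 0%nat x)
  by (intros; apply vfun_n_0; assumption).
assert (D1 : forall x, 0 < x -> is_derive v x (V 1%nat x)).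
{ intros x H0; apply is_derive_ext_loc with (V 0%nat).
  - apply Near; [exact H0|]; intros; symmetry; apply V0; assumption.
  - apply is_derive_vfun_n; [exact H|apply le_S, le_n|exact H0]. }
assert (V1 : forall x, 0 < x -> v' x = V 1%nat x)
  by (intros; apply is_derive_unique, D1; assumption).
assert (D2 : forall x, 0 < x -> is_derive v' x (V 2%nat x)).
{ intros x H0; apply is_derive_ext_loc with (V 1%nat).
  - apply Near; [exact H0|]; intros; symmetry; apply V1; assumption.
  - apply is_derive_vfun_n; [exact H|apply le_n|exact H0]. }
assert (V2 : forall x, 0 < x -> v'' x = V 2%nat x)
  by (intros; apply is_derive_unique, D2; assumption).
assert (Neg : forall x, V 2%nat x < 0) by (intro; apply vfun_2_neg, H).
assert (Dec : decreasing_on_pos v')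
  by (apply derive_neg_decreasing with (V 2%nat); [exact D2|intros; apply Neg]).
assert (Rat : decreasing_on_pos (fun x => v' x / v'' x)).
{ intros x y H0 Hxy; rewrite !V1, !V2 by lra; apply vfun_ratio_decreasing; assumption. }
assert (Vb : v b2 = f1 mu sigma delta gamma).
{ rewrite V0 by lra; unfold V, vfun_n.
  rewrite !glue_right by (fold b1; lra).
  rewrite <- tail_b2; [apply coefficients, H|exact H|apply le_S, le_S, le_n]. }
assert (Vb' : v' b2 = 1).
{ rewrite V1 by lra; unfold V, vfun_n.
  rewrite !glue_right by (fold b1; lra).
  rewrite <- tail_b2; [apply coefficients, H|exact H|apply le_S, le_n]. }
assert (First : forall x, 0 < x < b1 ->
  v' x / v'' x = x / (expo mu sigma delta - 1)).
{ intros x Hx1; rewrite V1, V2 by lra; unfold V, vfun_n.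
  rewrite !glue_left by apply Hx1; apply power_ratio; lra. }
(* Second-order matching allows the quotient at b1 to be computed from the power piece. *)
assert (At : - (mu / sigma ^ 2 * (v' b1 / v'' b1)) = 1).
{ rewrite V1, V2 by lra; unfold V, vfun_n.
  rewrite !(glue_right (xhat mu sigma delta)) by apply Rle_refl; unfold b1.
  rewrite <- !join_xhat; try assumption; try apply le_n; try apply le_S, le_n.
  rewrite power_ratio by assumption.
  replace (- (mu / sigma ^ 2 * (xhat mu sigma delta / (expo mu sigma delta - 1))))
    with (xhat mu sigma delta * mu / (sigma ^ 2 * (1 - expo mu sigma delta)))
    by (field; lra).
  rewrite xhat_mul by assumption; field; lra. }
assert (Hms : 0 < mu / sigma ^ 2) by (apply Rdiv_lt_0_compat; lra).
split; [|split; [|split; [|split; [|split; [|split; [|split; [|split; [|split; [|split]]]]]]]]].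
(* v' is strictly decreasing with v'(b2) = 1, so the set is exactly the half-line beyond b2. *)
- apply Glb_Rbar_gt; intro x; split.
  + intros [H0 H1]; apply Rnot_le_lt; intros [H2| ->]; [|lra].
    pose proof (Dec x b2 H0 H2); lra.
  + intro H1; split; [lra|rewrite <- Vb'; apply Dec; lra].
- intros x H0; split; [eexists; apply D1, H0|split; [eexists; apply D2, H0|]].
  apply continuous_ext_loc with (V 2%nat); [|apply continuous_vfun_2; assumption].
  apply Near; [exact H0|intros; symmetry; apply V2; assumption].
- apply derive_pos_increasing with (V 1%nat); [exact D1|].
  intros; apply vfun_1_pos, H.
- apply derive_decreasing_concave with v'; [|exact Dec].
  intros x H0; rewrite V1 by exact H0; apply D1, H0.
- intros x H0; rewrite V2 by exact H0; specialize (Neg x); lra.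
- intros x Hx1; unfold indicator_gt; destruct (Rlt_dec b2 x); [lra|].
  rewrite V0, V1, V2 by lra; unfold V, vfun_n; rewrite !glue_left by apply Hx1.
  simpl power_n; rewrite !Rpower_minus_1 by lra.
  pose proof (exp_pos (expo mu sigma delta * ln x)) as He.
  fold (Rpower x (expo mu sigma delta)) in He.
  set (P := Rpower x _) in *; set (c := c41 _ _ _ _ _) in *.
  (* The condition on p under which c x^p solves the first equation. *)
  assert (E : mu ^ 2 * expo mu sigma delta
              = 2 * delta * (sigma ^ 2 * (1 - expo mu sigma delta))).
  { rewrite <- xhat_mul by assumption.
    rewrite (expo_div_xhat mu sigma delta Hm Hs Hd) at 1; field; lra. }
  set (p := expo mu sigma delta) in *.
  transitivity (c * P * (mu ^ 2 * p / (2 * (sigma ^ 2 * (1 - p))) - delta));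
    [field; lra|rewrite E; field; lra].
- intros x Hx1; rewrite Vb.
  rewrite V0, V1, V2 by lra; unfold V, vfun_n.
  rewrite !(glue_right (xhat mu sigma delta)) by (fold b1; lra).
  unfold indicator_gt; destruct (Rtotal_order x b2) as [Hx2|[->|Hx2]].
  + rewrite !glue_left by exact Hx2; destruct (Rlt_dec b2 x); [lra|].
    pose proof (h3_n_ode mu sigma delta (x - xhat mu sigma delta) Hm Hs Hd) as O.
    rewrite Rmult_0_r, Rplus_0_r.
    set (h := h3_n mu sigma delta) in *; set (c := c41 _ _ _ _ _) in *.
    transitivity (c * (sigma ^ 2 / 2 * h 2%nat (x - xhat mu sigma delta)
                       + mu * h 1%nat (x - xhat mu sigma delta)
                       - delta * h 0%nat (x - xhat mu sigma delta))); [field|].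
    rewrite O; ring.
  (* At b2 the indicator vanishes while [glue] selects the tail; matching brings back the middle
     piece and its ODE. *)
  + rewrite !glue_right by lra; destruct (Rlt_dec b2 b2); [lra|].
    rewrite <- !tail_b2; try assumption; try apply le_n; try apply le_S, le_n;
      try apply le_S, le_S, le_n.
    pose proof (h3_n_ode mu sigma delta (b2 - xhat mu sigma delta) Hm Hs Hd) as O.
    rewrite Rmult_0_r, Rplus_0_r.
    set (h := h3_n mu sigma delta) in *; set (c := c41 _ _ _ _ _) in *.
    transitivity (c * (sigma ^ 2 / 2 * h 2%nat (b2 - xhat mu sigma delta)
                       + mu * h 1%nat (b2 - xhat mu sigma delta)
                       - delta * h 0%nat (b2 - xhat mu sigma delta))); [field|].
    rewrite O; ring.
  + rewrite !glue_right by lra; destruct (Rlt_dec b2 x); [|lra].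
    destruct (coefficients _ _ _ _ _ H) as [_ [C0 _]].
    unfold tail, tail_n; rewrite h3_eq, C0 by assumption.
    destruct (lambda_spec mu sigma delta gamma Hm Hs Hd Hg) as [_ L1].
    unfold quad in L1; set (l := lambda _ _ _ _) in *.
    (* The affine part of the tail cancels the source term, leaving the exponential times the
       quadratic at [lambda]. *)
    transitivity (c42 mu sigma delta gamma b2 * exp (l * (x - b2))
                  * (sigma ^ 2 / 2 * l ^ 2 + mu * l - (delta + gamma)));
      [simpl; field; lra|rewrite L1; ring].
- unfold v, vfun; destruct (Rle_dec 0 0); lra.
- exact Rat.
(* Near 0 the ratio v'/v'' is x/(expo - 1), so the limit is 0. *)
- exists 0; split; [|lra].
  apply filterlim_ext_loc
    with (fun x => mu / sigma ^ 2 * (x / (expo mu sigma delta - 1))).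
  + exists (mkposreal b1 Hx); intros x Hx1 H0.
    assert (x < b1).
    { unfold ball in Hx1; simpl in Hx1; unfold AbsRing_ball, abs, minus, plus, opp in Hx1.
      simpl in Hx1; apply Rabs_def2 in Hx1; lra. }
    rewrite First; [reflexivity|lra].
  + assert (Ct : continuous
      (fun x => mu / sigma ^ 2 * (x / (expo mu sigma delta - 1))) 0).
    { apply (ex_derive_continuous (fun x => mu / sigma ^ 2 * (x / _))).
      auto_derive; lra. }
    unfold continuous in Ct.
    replace (mu / sigma ^ 2 * (0 / (expo mu sigma delta - 1))) with 0 in Ct
      by (field; lra).
    intros P HP; apply filter_le_within, Ct, HP.
(* The quantity equals 1 at b1 and is strictly increasing, so b1 is the least element of the set. *)
- apply Glb_Rbar_min; [lra|].
  intros x [H0 H1]; apply Rnot_lt_le; intro Hx1.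
  pose proof (Rat x b1 H0 Hx1) as H2; cbv beta in H2; nra.
Qed.
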